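(* Let $q$ be a prime power, $n\ge 1$, and let $V$ be an $(n+1)$-dimensional vector space over $\mathbb F_q$ with dual $V^*$. Let $\Lambda_1$ be the set of points of $\mathrm{PG}(V\otimes V^* )$ represented by the pure tensors $x\otimes\xi$ with $0\neq x\in V$, $0\neq\xi\in V^*$ and $\xi(x)=0$. Then the linear code $\mathcal C(\Lambda_1)$ associated to the projective system $\Lambda_1$ is an $[N_1,k_1,d_1]$-code with \[N_1=\frac{(q^{n+1}-1)(q^n-1)}{(q-1)^2},\qquad k_1=n^2+2n,\qquad d_1=q^{2n-1}-q^{n-1}.\]
   Context: For a spanning set $\Omega=\{[v_1],\dots,[v_N]\}$ of $N$ distinct points of a finite projective space $\mathrm{PG}(W)$ (a projective system), the code $\mathcal C(\Omega)$ is the $\mathbb F_q$-linear code of length $N$ whose generator matrix has as columns the coordinate vectors of fixed representatives $v_1,\dots,v_N$; it is well defined up to monomial equivalence. Here $\Lambda_1$ is viewed as a projective system of the subspace it spans. $[v]$ denotes the projective point spanned by a nonzero vector $v$. *)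

(* Defs.v *)
From HB Require Import structures.
From mathcomp Require Import all_boot all_order all_algebra all_field.
Set Implicit Arguments.
Unset Strict Implicit.
Unset Printing Implicit Defensive.
Import GRing.Theory.
Local Open Scope ring_scope.

Definition dual (F : fieldType) (V : vectType F) : vectType F := 'Hom(V, F^o).

(* (T, t) is a tensor product of U and W: every bilinear map out of U x W
   factors uniquely through t. *)
Definition is_tensor_product (F : fieldType) (U W T : vectType F)
    (t : {bilinear U -> W -> T}) : Prop :=
  forall (X : vectType F) (b : {bilinear U -> W -> X}),
    exists! f : 'Hom(T, X), forall x y, f (t x y) = b x y.

Section TensorProductExists.
Import VectorInternalTheory.

Lemma tensor_product_exists (F : fieldType) (U W : vectType F) :
  exists (T : vectType F) (t : {bilinear U -> W -> T}), is_tensor_product t.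
Proof.
pose m := dim U; pose n := dim W.
pose t0 (x : U) (y : W) : 'M[F]_(m, n) := (v2r x)^T *m v2r y.
have t0P : bilinear_for *:%R *:%R t0.
  split=> [y a x x'|x a y y']; rewrite /t0 /=.
    by rewrite !linearP /= mulmxDl -scalemxAl.
  by rewrite (linearP v2r a y y') mulmxDr -scalemxAr.
pose Bt := bilinear_isBilinear.Build F U W _ *:%R *:%R t0 t0P.
pose t : {bilinear U -> W -> 'M[F]_(m, n)} := HB.pack t0 Bt.
exists 'M[F]_(m, n), t => X b.
pose e i : U := r2v (delta_mx 0 i); pose g j : W := r2v (delta_mx 0 j).
have tE x y i j : t x y i j = v2r x 0 i * v2r y 0 j.
  by rewrite /t /= /t0 mxE big_ord1 mxE.
have teg i j : t (e i) (g j) = delta_mx i j.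
  by apply/matrixP=> k l; rewrite tE /e /g !r2vK !mxE eqxx /= -natrM mulnb.
pose f0 (M : 'M[F]_(m, n)) : X := \sum_i \sum_j M i j *: b (e i) (g j).
have f0P : linear f0.
  move=> a M M'; rewrite /f0 scaler_sumr -big_split; apply: eq_bigr => i _ /=.
  rewrite scaler_sumr -big_split; apply: eq_bigr => j _ /=.
  by rewrite !mxE scalerDl scalerA.
pose Lf := GRing.isLinear.Build F _ _ *:%R f0 f0P.
pose f : {linear 'M[F]_(m, n) -> X} := HB.pack f0 Lf.
exists (linfun f); split=> [x y|h hP].
  rewrite lfunE /= /f0.
  have Ex : \sum_i v2r x 0 i *: e i = x.
    rewrite -[RHS]v2rK [in RHS](row_sum_delta (v2r x)) linear_sum.
    by apply: eq_bigr => i _; rewrite linearZ.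
  have Ey : \sum_i v2r y 0 i *: g i = y.
    rewrite -[RHS]v2rK [in RHS](row_sum_delta (v2r y)) linear_sum.
    by apply: eq_bigr => i _; rewrite linearZ.
  rewrite -[in RHS]Ex linear_sumlz /=; apply: eq_bigr => i _.
  rewrite linearZl_LR /= -[in RHS]Ey linear_sumr scaler_sumr.
  by apply: eq_bigr => j _; rewrite linearZr_LR scalerA -tE.
apply/lfunP=> M; rewrite lfunE /= /f0 [in RHS](matrix_sum_delta M) linear_sum.
apply: eq_bigr => i _; rewrite linear_sum; apply: eq_bigr => j _.
by rewrite linearZ /= -teg hP.
Qed.

End TensorProductExists.

(* A point [v] of PG(T) is the line <[v]> with v != 0; a set of points is a
   predicate on {vspace T}. *)
Definition represents (F : fieldType) (T : vectType F) (N : nat)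
    (v : N.-tuple T) (Omega : {vspace T} -> Prop) : Prop :=
  [/\ forall i, tnth v i != 0,
      injective (fun i => <[tnth v i]>%VS)
    & forall P, Omega P <-> exists i, P = <[tnth v i]>%VS].

Definition generator_matrix (F : fieldType) (T : vectType F) (N k : nat)
    (v : N.-tuple T) (e : k.-tuple T) : 'M[F]_(k, N) :=
  \matrix_(i < k, j < N) coord e i (tnth v j).

Definition row_code (F : fieldType) (k N : nat) (G : 'M[F]_(k, N)) :
    {vspace 'rV[F]_N} :=
  <<[seq row i G | i : 'I_k]>>%VS.

(* C is the code C(Omega), Omega being viewed as a projective system of its
   span, for some choice of representatives of the points, of their order, and
   of a basis of the span. *)
Definition is_code_of (F : fieldType) (T : vectType F)
    (Omega : {vspace T} -> Prop) (N : nat) (C : {vspace 'rV[F]_N}) : Prop :=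
  exists (v : N.-tuple T) (k : nat) (e : k.-tuple T),
    [/\ represents v Omega, basis_of <<v>>%VS e
      & C = row_code (generator_matrix v e)].

Definition hamming_dist (F : fieldType) (N : nat) (c c' : 'rV[F]_N) : nat :=
  #|[set i | c 0 i != c' 0 i]|.

Definition min_distance (F : fieldType) (N : nat) (C : {vspace 'rV[F]_N})
    (d : nat) : Prop :=
  (exists c c', [/\ c \in C, c' \in C, c != c' & hamming_dist c c' = d]) /\
  (forall c c', c \in C -> c' \in C -> c != c' -> (d <= hamming_dist c c')%N).

Definition Lambda1 (F : fieldType) (V T : vectType F)
    (t : {bilinear V -> dual V -> T}) (P : {vspace T}) : Prop :=
  exists (x : V) (xi : dual V),
    [/\ x != 0, xi != 0, (xi : 'Hom(V, F^o)) x = 0 & P = <[t x xi]>%VS].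

(* Main.v *)
Require Import Defs.
From HB Require Import structures.
From mathcomp Require Import all_boot all_order all_algebra all_field.
From mathcomp Require Import mxabelem zify.
Set Implicit Arguments.
Unset Strict Implicit.
Unset Printing Implicit Defensive.
Import GRing.Theory.
Local Open Scope ring_scope.

(* In coordinates, x (x) xi is the matrix y^T x with x, y row vectors and
   xi(x) = x y^T, and a linear functional is M |-> tr(A M), with value x A y^T
   on y^T x. The span of the system is the space of trace-zero matrices, which
   gives the dimension. If x is not an eigenvector of A, there are
   q^n - q^(n-1) vectors y with x y^T = 0 and x A y^T <> 0, and none otherwise,
   so the weight of the codeword of A is q^(n-1) times the number of points [x]
   with x not an eigenvector. If a is an eigenvalue of a nonscalar A, each eigenvector lies
   in ker(A - a) or in im(A - a), whose dimensions add up to n + 1; hence A has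
   at most (q^n - 1) + (q - 1) eigenvectors, with equality for a projection of
   rank 1. *)

(** * Counting eigenvectors and flags over a finite field *)

Lemma card_sub_mx (F : finFieldType) m n (A : 'M[F]_(m, n)) :
  #|[set u : 'rV_n | (u <= A)%MS]| = (#|F| ^ \rank A)%N.
Proof.
by rewrite -card_rowg; apply: eq_card => u; rewrite !inE.
Qed.

Lemma card_orthogonal (F : finFieldType) m k (B : 'M[F]_(k, m)) :
  #|[set y : 'rV_m | B *m y^T == 0]| = (#|F| ^ (m - \rank B))%N.
Proof.
rewrite -[\rank B]mxrank_tr -mxrank_ker -card_sub_mx; apply: eq_card => y.
by rewrite !inE sub_kermx -(inj_eq trmx_inj) trmx_mul trmxK trmx0.
Qed.

Lemma card_neq0 (F : finFieldType) : #|[set a : F | a != 0]| = #|F|.-1.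
Proof.
by rewrite -(cardsC1 (0 : F)); apply: eq_card => a; rewrite !inE.
Qed.

(** The zero vector belongs to the set, so the bound is one more than the largest number
    [(q^n - 1) + (q - 1)] of eigenvectors. *)
Lemma card_eigen_le (F : finFieldType) n (A : 'M[F]_n.+1) :
    (0 < n)%N -> ~~ is_scalar_mx A ->
  (#|[set x : 'rV_n.+1 | (x *m A <= x)%MS]| <= #|F| ^ n + #|F| - 1)%N.
Proof.
move=> n_gt0 nsA; have q_gt1 : (1 < #|F|)%N := card_finNzRing_gt1 F.
set S := [set x | _]; have q_gt0 : (0 < #|F| ^ n)%N by rewrite expn_gt0 ltnW.
have [/existsP[x /andP[x0 xA]]|/existsPn noE] :=
  boolP [exists x : 'rV_n.+1, (x != 0) && (x *m A <= x)%MS]; last first.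
  have: S \subset [set 0].
    by apply/subsetP=> x; have := noE x; rewrite !inE; case: eqP => //= _ /negP.
  by move/subset_leq_card; rewrite cards1 => h; apply: leq_trans h _; lia.
have [a xAa] := sub_rVP xA; set B := A - a%:M.
have xB : x *m B = 0 by rewrite mulmxBr mul_mx_scalar xAa subrr.
have r_gt0 : (0 < \rank B)%N.
  rewrite lt0n mxrank_eq0 subr_eq0; apply: contra nsA => /eqP->.
  exact: scalar_mx_is_scalar.
have r_lt : (\rank B <= n)%N.
  rewrite -ltnS ltn_neqAle rank_leq_row andbT; apply: contra x0 => /eqP rB.
  have Bf : row_free B by rewrite /row_free rB.
  by rewrite -(mulmx_free_eq0 x Bf) xB.
pose K := [set u : 'rV_n.+1 | (u <= kermx B)%MS].
pose W := [set u : 'rV_n.+1 | (u <= B)%MS].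
(* An eigenvector of another eigenvalue [b] is in the image of [A - a]. *)
have sub : S \subset K :|: W.
  apply/subsetP=> u; rewrite !inE sub_kermx => /sub_rVP[b ub].
  have uB : u *m B = (b - a) *: u by rewrite mulmxBr mul_mx_scalar ub scalerBl.
  rewrite uB; have [->|ba] := eqVneq b a; first by rewrite subrr scale0r eqxx.
  apply/orP; right; rewrite -(eqmx_scale u (_ : b - a != 0)) ?subr_eq0 //.
  by rewrite -uB submxMl.
have UI := cardsUI K W; rewrite !card_sub_mx mxrank_ker in UI.
(* Zero lies in both subspaces, so [K :|: W] has at most [#|K| + #|W| - 1] elements. *)
have I0 : (0 < #|K :&: W|)%N by apply/card_gt0P; exists 0; rewrite !inE !sub0mx.
apply: leq_trans (subset_leq_card sub) _.
have [r rB] : exists r, \rank B = r.+1 by exists (\rank B).-1; rewrite prednK.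
have [s ns] : exists s, n = (r + s).+1 by exists (n - r.+1)%N; lia.
suff : (#|F| ^ (n.+1 - \rank B) + #|F| ^ \rank B <= #|F| ^ n + #|F|)%N.
  by move: UI I0; move: #|_ :&: _| #|_ :|: _| => *; lia.
rewrite rB; have -> : (n.+1 - r.+1 = s.+1)%N by lia.
rewrite ns !expnS expnD.
have : (0 < #|F| ^ r)%N by rewrite expn_gt0 ltnW.
have : (0 < #|F| ^ s)%N by rewrite expn_gt0 ltnW.
(* With [a' = q^r] and [b' = q^s], both positive, the claim is [q] times
   [(a' - 1) * (b' - 1) >= 0]. *)
move: (#|F| ^ r)%N (#|F| ^ s)%N => a' b' *.
have: ((a' + b') * #|F| <= (a' * b' + 1) * #|F|)%N by rewrite leq_mul2r; nia.
lia.
Qed.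

(** The matrix keeps only the coordinate [x 0 0], so a solution lies in the kernel, of size [q^n],
    or in the image, of size [q], and these meet only in zero. *)
Lemma card_eigen_delta (F : finFieldType) n :
  #|[set x : 'rV[F]_n.+1 | (x *m delta_mx 0 0 <= x)%MS]|
    = (#|F| ^ n + #|F| - 1)%N.
Proof.
pose A : 'M[F]_n.+1 := delta_mx 0 0.
have AE (x : 'rV[F]_n.+1) : x *m A = x 0 0 *: delta_mx 0 0.
  apply/rowP=> j; rewrite !mxE (bigD1 ord0) //= big1 ?addr0 => [|i i0].
    by rewrite !mxE eqxx.
  by rewrite !mxE (negPf i0) mulr0.
have SE : [set x : 'rV_n.+1 | (x *m A <= x)%MS]
    = [set x | (x <= kermx A)%MS] :|: [set x | (x <= A)%MS].
  apply/setP=> x; rewrite !inE sub_kermx AE.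
  apply/idP/idP => [xA|/orP[/eqP->|/submxP[w ->]]].
  - have [->|x0] := eqVneq (x 0 0) 0; first by rewrite scale0r eqxx.
    move: xA; rewrite eqmx_scale // => /sub_rVP[b db]; apply/orP; right.
    have b0 : b != 0.
      apply: contra_eq_neq db => ->; rewrite scale0r; apply/eqP => /rowP/(_ 0).
      by rewrite !mxE; apply/eqP; rewrite oner_neq0.
    rewrite -(eqmx_scale x b0) -db; apply/submxP; exists (delta_mx 0 0).
    by rewrite AE mxE !eqxx scale1r.
  - exact: sub0mx.
  - by rewrite !AE !mxE !eqxx mulr1.
have I0 : [set x : 'rV_n.+1 | (x <= kermx A)%MS] :&: [set x | (x <= A)%MS]
    = [set 0].
  apply/setP=> x; rewrite !inE sub_kermx.
  apply/andP/eqP => [[/eqP xA /submxP[w xw]]|->].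
    by move: xA; rewrite xw !AE !mxE !eqxx mulr1.
  by rewrite mul0mx sub0mx.
have := cardsUI [set x : 'rV_n.+1 | (x <= kermx A)%MS] [set x | (x <= A)%MS].
rewrite -SE I0 !card_sub_mx cards1 mxrank_ker mxrank_delta expn1 subSS subn0 => <-.
by rewrite addnK.
Qed.

Lemma card_nonzero_flags (F : finFieldType) n (A : 'M[F]_n.+1) : (0 < n)%N ->
  #|[set p : 'rV[F]_n.+1 * 'rV[F]_n.+1 |
       (p.1 *m p.2^T == 0) && (p.1 *m A *m p.2^T != 0)]|
  = (#|F| ^ n.-1 * #|F|.-1 * #|~: [set x : 'rV_n.+1 | (x *m A <= x)%MS]|)%N.
Proof.
move=> n_gt0; rewrite -sum1dep_card.
rewrite -(pair_big_dep predT (fun x y : 'rV_n.+1 =>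
   (x *m y^T == 0) && (x *m A *m y^T != 0)) (fun _ _ => 1%N)) /=.
rewrite (bigID (fun x : 'rV_n.+1 => (x *m A <= x)%MS)) /= big1 ?add0n.
  rewrite mulnC -sum_nat_const; apply: eq_big => [x|x nxA]; first by rewrite !inE.
  have x0 : x != 0 by apply: contra nxA => /eqP->; rewrite mul0mx sub0mx.
  have := cardsID [set y : 'rV_n.+1 | x *m A *m y^T == 0]
                  [set y | x *m y^T == 0].
  rewrite card_orthogonal rank_rV x0.
  have -> : [set y : 'rV_n.+1 | x *m y^T == 0]
      :&: [set y | x *m A *m y^T == 0] = [set y | col_mx x (x *m A) *m y^T == 0].
    by apply/setP=> y; rewrite !inE mul_col_mx col_mx_eq0.
  rewrite card_orthogonal -addsmxE.
  (* As [x] is not an eigenvector, [x] and [x A] are independent, so the two linear conditions on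
     [y] cut out a space of dimension [n - 1]. *)
  have -> : \rank (x + x *m A)%MS = 2.
    apply/eqP; rewrite eqn_leq; apply/andP; split.
      apply: leq_trans (mxrank_adds_leqif _ _) _.
      by rewrite !rank_rV; case: eqP; case: eqP.
    have : (x < x + x *m A)%MS by rewrite ltmxE addsmxSl addsmx_sub submx_refl.
    by move/rank_ltmx; rewrite rank_rV x0.
  (* Here [true] is the rank 1 of the nonzero row [x]. *)
  have -> : (n.+1 - true = n.-1.+1)%N by case: (n) n_gt0 => //= k; lia.
  have -> : (n.+1 - 2 = n.-1)%N by lia.
  have -> : (\sum_(y : 'rV_n.+1 | (x *m y^T == 0%R) && (x *m A *m y^T != 0%R)) 1
      = #|[set y : 'rV_n.+1 | x *m y^T == 0%R] :\: [set y : 'rV_n.+1 | x *m A *m y^T == 0%R]|)%N.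
    by rewrite sum1dep_card; apply: eq_card => y; rewrite !inE andbC.
  rewrite expnS; move: #|_ :\: _| => d H.
  have q_gt1 : (1 < #|F|)%N := card_finNzRing_gt1 F.
  rewrite -subn1; move: (#|F| ^ n.-1)%N #|F| q_gt1 H => a b b1 H; nia.
(* If [x A = a x], then [x A y^T = a (x y^T)], so no [y] meets both conditions. *)
move=> x /sub_rVP[a ->]; rewrite big1 // => y.
by rewrite -scalemxAl => /andP[/eqP->]; rewrite scaler0 eqxx.
Qed.

(** For each nonzero [x], the vector [y] runs over the [q^n - 1] nonzero vectors of a hyperplane. *)
Lemma card_flags (F : finFieldType) n :
  #|[set p : 'rV[F]_n.+1 * 'rV[F]_n.+1 |
       [&& p.1 *m p.2^T == 0, p.1 != 0 & p.2 != 0]]|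
  = ((#|F| ^ n.+1 - 1) * (#|F| ^ n - 1))%N.
Proof.
rewrite -sum1dep_card.
rewrite -(pair_big_dep predT (fun x y : 'rV_n.+1 =>
   [&& x *m y^T == 0%R, x != 0%R & y != 0%R]) (fun _ _ => 1%N)) /=.
rewrite (bigD1 (0%R : 'rV[F]_n.+1)) //= big1 ?add0n => [|y]; last first.
  by rewrite eqxx andbF.
have -> : (#|F| ^ n.+1 - 1 = #|[set~ (0%R : 'rV[F]_n.+1)]|)%N.
  by rewrite cardsC1 card_mx mul1n subn1.
rewrite -sum_nat_const; apply: eq_big => [x|x x0]; first by rewrite !inE.
have -> : (#|F| ^ n - 1 = #|[set y : 'rV_n.+1 | x *m y^T == 0%R] :\ 0%R|)%N.
  have := cardsD1 0 [set y : 'rV_n.+1 | x *m y^T == 0].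
  by rewrite card_orthogonal rank_rV x0 inE trmx0 mulmx0 eqxx !subn1 /= => ->.
rewrite -sum1_card; apply: eq_bigl => y.
by rewrite !inE x0 andbC.
Qed.

(** * Lines and rank-one matrices *)

Lemma vlineZ (F : fieldType) (T : vectType F) (a : F) (v : T) :
  a != 0 -> <[a *: v]>%VS = <[v]>%VS.
Proof.
move=> a0; apply/eqP; rewrite eqEsubv -!memvE memvZ ?memv_line //=.
by apply/vlineP; exists a^-1; rewrite scalerA mulVf // scale1r.
Qed.

Lemma vline_eqP (F : fieldType) (T : vectType F) (u v : T) : u != 0 ->
  reflect (exists2 a : F, a != 0 & u = a *: v) (<[u]>%VS == <[v]>%VS).
Proof.
move=> u0; apply: (iffP eqP) => [uv|[a a0 ->]]; last exact: vlineZ.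
have /vlineP[a ua] : u \in <[v]>%VS by rewrite -uv memv_line.
by exists a => //; apply: contra u0 => /eqP a0; rewrite ua a0 scale0r.
Qed.

Section Dyads.
Variables (F : fieldType) (m : nat).
Implicit Types x y : 'rV[F]_m.

Lemma dyadE y x i j : (y^T *m x) i j = y 0 i * x 0 j.
Proof. by rewrite mxE big_ord1 mxE. Qed.

Lemma dyad_neq0 y x : y != 0 -> x != 0 -> y^T *m x != 0.
Proof.
case/rV0Pn=> i yi /rV0Pn[j xj]; apply/eqP=> /matrixP/(_ i j).
by rewrite dyadE mxE => /eqP; rewrite mulf_eq0 (negPf yi) (negPf xj).
Qed.

(** Row [i] of the equation reads [y_i x = y0_i x0], and [i] is chosen with [y_i] nonzero.
    Transposing gives the same for the other factor. *)
Lemma dyad_proportional y x y0 x0 : y != 0 -> y^T *m x = y0^T *m x0 ->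
  exists a, x = a *: x0.
Proof.
case/rV0Pn=> i yi E; exists (y0 0 i / y 0 i); apply/rowP=> j.
move/matrixP/(_ i j): E; rewrite !dyadE mxE mulrAC => <-.
by rewrite mulrAC mulfV // mul1r.
Qed.

Lemma dyadZ a b y x : (b *: y)^T *m (a *: x) = (a * b) *: (y^T *m x).
Proof. by rewrite -scalemxAr linearZ /= -scalemxAl scalerA. Qed.

(** By cyclicity the trace is the single entry of [x A y^T]. Only its vanishing matters for
    weights. *)
Lemma mxtrace_dyad (A : 'M[F]_m) y x :
  (\tr (A *m (y^T *m x)) == 0) = (x *m A *m y^T == 0).
Proof.
rewrite mulmxA mxtrace_mulC mulmxA /mxtrace big_ord1.
apply/eqP/eqP=> [E|->]; last by rewrite mxE.
by apply/matrixP=> i j; rewrite !ord1 E mxE.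
Qed.

End Dyads.

(* Point-hyperplane flags: the matrix [y^T *m x] is the pure tensor of [x] and
   the functional [z |-> z y^T]. *)
Definition flag_points (F : fieldType) m (P : {vspace 'M[F]_m}) : Prop :=
  exists x y : 'rV[F]_m,
    [/\ x != 0, y != 0, x *m y^T = 0 & P = <[y^T *m x]>%VS].

(** * Length, weights and span of the system of flag matrices *)

Section Flags.
Variables (F : finFieldType) (n N : nat) (w : N.-tuple 'M[F]_n.+1).
Hypothesis wP : represents w (@flag_points F n.+1).
Local Notation q := #|F|.

Definition is_flag (p : 'rV[F]_n.+1 * 'rV[F]_n.+1) :=
  [&& p.1 *m p.2^T == 0, p.1 != 0 & p.2 != 0].

(** If [(x0, y0)] is one flag on the point, the others are exactly the [(a *: x0, b *: y0)] with [a]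
    and [b] nonzero. *)
Lemma card_dyad_fiber j :
  #|[set p | is_flag p && (<[p.2^T *m p.1]>%VS == <[tnth w j]>%VS)]|
  = (q.-1 ^ 2)%N.
Proof.
case: wP => _ _ wF.
have [x0 [y0 [x00 y00 xy0 ->]]] : flag_points <[tnth w j]>%VS.
  by apply/wF; exists j.
pose D := [set a : F | a != 0].
have -> : [set p | is_flag p && (<[p.2^T *m p.1]>%VS == <[y0^T *m x0]>%VS)]
    = [set (ab.1 *: x0, ab.2 *: y0) | ab in setX D D].
  apply/setP=> -[x y]; rewrite !inE /=; apply/idP/imsetP; last first.
    case=> -[a b]; rewrite !inE /= => /andP[a0 b0] [-> ->].
    rewrite dyadZ /is_flag /= !scaler_eq0 !negb_or a0 b0 x00 y00.
    rewrite -scalemxAl linearZ /= -scalemxAr xy0 !scaler0 eqxx /=.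
    by rewrite vlineZ ?mulf_neq0.
  rewrite /is_flag /= => /andP[/and3P[/eqP xy x_n0 y_n0]].
  case/(vline_eqP _ (dyad_neq0 y_n0 x_n0)) => c c0 E.
  have [a xa] : exists a, x = a *: x0.
    apply: (@dyad_proportional _ _ y x (c *: y0)) => //.
    by rewrite E linearZ /= -scalemxAl.
  have [b yb] : exists b, y = b *: y0.
    apply: (@dyad_proportional _ _ x y (c *: x0)) => //.
    rewrite -[LHS]trmxK trmx_mul trmxK E linearZ /= trmx_mul trmxK.
    by rewrite linearZ /= -scalemxAl.
  exists (a, b); rewrite ?inE /= ?xa ?yb //.
  by move: x_n0 y_n0; rewrite xa yb !scaler_eq0 !negb_or => /andP[-> _] /andP[->].
rewrite card_in_imset ?cardsX ?card_neq0 ?mulnn // => -[a b] [a' b'] _ _ /=.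
case=> /eqP; rewrite -subr_eq0 -scalerBl scaler_eq0 (negPf x00) orbF subr_eq0.
move=> /eqP-> /eqP; rewrite -subr_eq0 -scalerBl scaler_eq0 (negPf y00) orbF.
by rewrite subr_eq0 => /eqP->.
Qed.

(** Double counting of incidences between flags and indices: each flag lies over one index, each
    index under [(q - 1)^2] flags. Constant [Q] gives the length, a nonvanishing trace gives the
    weights. *)
Lemma card_representatives (Q : pred 'M[F]_n.+1) :
    (forall c M, c != 0 -> Q (c *: M) = Q M) ->
  (#|[set j | Q (tnth w j)]| * q.-1 ^ 2)%N
    = #|[set p | is_flag p && Q (p.2^T *m p.1)]|.
Proof.
case: (wP) => w0 winj wF QZ; rewrite -sum_nat_const -sum1dep_card.
have E p : is_flag p && Q (p.2^T *m p.1) ->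
    (\sum_(j | Q (tnth w j) && (<[p.2^T *m p.1]>%VS == <[tnth w j]>%VS)) 1 = 1)%N.
  case: p => x y /= /andP[/and3P[/eqP xy x0 y0] Qyx].
  have [j Ej] : exists j, <[y^T *m x]>%VS = <[tnth w j]>%VS.
    by apply/wF; exists x, y.
  rewrite (big_pred1 j) // => i; rewrite /= Ej.
  apply/andP/eqP => [[_ /eqP/winj->] //|->]; split=> //.
  have /eqP/(vline_eqP _ (dyad_neq0 y0 x0))[c c0 Ec] := Ej.
  by rewrite -(QZ c) // -Ec.
rewrite -(eq_bigr _ E) (exchange_big_dep (fun j => Q (tnth w j))) /=; last first.
  by move=> p j _ /andP[].
apply: eq_big => [j|j]; rewrite inE // => Qj.
rewrite -(card_dyad_fiber j) -sum1dep_card; apply: eq_bigl => p.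
rewrite Qj /=; case Fp: (is_flag p) => //=.
case/and3P: Fp => _ x0 y0; case Ej: (<[_]>%VS == _); rewrite ?andbF // andbT.
have /(vline_eqP _ (dyad_neq0 y0 x0))[c c0 ->] := Ej.
by rewrite QZ // Qj.
Qed.

Lemma card_flag_points : (N * q.-1 ^ 2 = (q ^ n.+1 - 1) * (q ^ n - 1))%N.
Proof.
rewrite -card_flags; have := @card_representatives predT (fun _ _ _ => erefl).
have -> : [set j | predT (tnth w j)] = setT by apply/setP=> j; rewrite !inE.
by rewrite cardsT card_ord => ->; apply: eq_card => p; rewrite !inE andbT.
Qed.

(** The Hamming weight of the codeword of the functional [M |-> tr(A M)]. *)
Definition weight (A : 'M[F]_n.+1) := #|[set j | \tr (A *m tnth w j) != 0]|.

Lemma weightE A : (0 < n)%N ->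
  (weight A * q.-1
     = q ^ n.-1 * #|~: [set x : 'rV_n.+1 | (x *m A <= x)%MS]|)%N.
Proof.
move=> n_gt0; have q1 : (0 < q.-1)%N by rewrite -subn1 subn_gt0 card_finNzRing_gt1.
(* A second factor [q - 1] turns both sides into counts of pairs [(x, y)], with [(q - 1)^2] pairs
   for each point. *)
apply/eqP; rewrite -(eqn_pmul2r q1) -mulnA mulnn mulnAC -card_nonzero_flags //.
rewrite (@card_representatives (fun M => \tr (A *m M) != 0)) => [|c M c0].
  apply/eqP/eq_card=> -[x y]; rewrite !inE /is_flag /= mxtrace_dyad.
  have [->|x0] := eqVneq x 0; first by rewrite !mul0mx eqxx.
  by have [->|] := eqVneq y 0; rewrite ?trmx0 ?mulmx0 ?eqxx ?andbT.
by rewrite -scalemxAr linearZ mulf_eq0 negb_or c0.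
Qed.

Lemma weight_ge A : (0 < n)%N -> ~~ is_scalar_mx A ->
  (q ^ n.-1 * (q ^ n - 1) <= weight A)%N.
Proof.
move=> n_gt0 nsA; have q1 : (1 < q)%N := card_finNzRing_gt1 F.
have q1' : (0 < q.-1)%N by rewrite -subn1 subn_gt0.
rewrite -(leq_pmul2r q1') weightE // -mulnA leq_mul2l; apply/orP; right.
rewrite cardsCs setCK card_mx mul1n.
apply: leq_trans (leq_sub2l _ (card_eigen_le n_gt0 nsA)).
(* This is [q^(n+1) - (q^n + q - 1) = (q - 1) * (q^n - 1)]. *)
rewrite expnS -subn1; move: (q ^ n)%N #|F| q1 => a b; clear; nia.
Qed.

Lemma weight_delta : (0 < n)%N ->
  weight (delta_mx 0 0) = (q ^ n.-1 * (q ^ n - 1))%N.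
Proof.
move=> n_gt0; have q1 : (1 < q)%N := card_finNzRing_gt1 F.
have q1' : (0 < q.-1)%N by rewrite -subn1 subn_gt0.
apply/eqP; rewrite -(eqn_pmul2r q1') weightE // -mulnA; apply/eqP; congr (_ * _)%N.
rewrite cardsCs setCK card_mx mul1n card_eigen_delta.
have : (0 < q ^ n)%N by rewrite expn_gt0 ltnW.
rewrite expnS -subn1; move: (q ^ n)%N #|F| q1 => a b; clear; nia.
Qed.

(** On a flag, [tr(a y^T x) = a (x y^T) = 0]. Hence scalar matrices are excluded in [weight_ge]. *)
Lemma weight_scalar a : weight a%:M = 0%N.
Proof.
case: wP => _ _ wF; apply/eqP; rewrite cards_eq0; apply/eqP/setP=> j.
rewrite !inE; apply/negbTE; rewrite negbK.
have [x [y [x0 y0 xy E]]] : flag_points <[tnth w j]>%VS by apply/wF; exists j.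
have /vlineP[c ->] : tnth w j \in <[y^T *m x]>%VS by rewrite -E memv_line.
rewrite -scalemxAr mxtraceZ mulf_eq0; apply/orP; right.
by rewrite mxtrace_dyad mul_mx_scalar -scalemxAl xy scaler0.
Qed.

Lemma dyad_in_span (x y : 'rV[F]_n.+1) :
  x *m y^T = 0 -> y^T *m x \in <<w>>%VS.
Proof.
case: wP => _ _ wF xy.
have [->|x0] := eqVneq x 0; first by rewrite mulmx0 mem0v.
have [->|y0] := eqVneq y 0; first by rewrite trmx0 mul0mx mem0v.
have [j Ej] : exists j, <[y^T *m x]>%VS = <[tnth w j]>%VS.
  by apply/wF; exists x, y.
rewrite memvE Ej -memvE; exact/memv_span/mem_tnth.
Qed.

Lemma span_flag_points :
  <<w>>%VS = lker (linfun (mxtrace : 'M[F]_n.+1 -> F^o)).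
Proof.
case: (wP) => _ _ wF; apply/eqP; rewrite eqEsubv; apply/andP; split.
  apply/span_subvP=> _ /tnthP[j ->]; rewrite memv_ker lfunE /=.
  have := weight_scalar 1; move/eqP; rewrite cards_eq0 => /eqP/setP/(_ j).
  by rewrite !inE mul1mx => /negbFE.
apply/subvP=> M; rewrite memv_ker lfunE /= => /eqP trM.
(* These matrices span the trace-zero ones: [E_ij] off the diagonal, [E_ii - E_00] on it. *)
pose d i j : 'M[F]_n.+1 := delta_mx i j - delta_mx 0 0 *+ (i == j).
have dE i j : delta_mx i j = (delta_mx 0 i : 'rV[F]_n.+1)^T *m delta_mx 0 j.
  by rewrite trmx_delta mul_delta_mx.
have d_in i j : d i j \in <<w>>%VS.
  rewrite /d; have [<-|ij] := eqVneq i j; last first.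
    rewrite subr0 dE; apply: dyad_in_span.
    by rewrite trmx_delta mul_delta_mx_0 // eq_sym.
  have [->|i0] := eqVneq i 0; first by rewrite subrr mem0v.
  have i0' : 0 != i by rewrite eq_sym.
  (* A diagonal difference is not a dyad, but it is a combination of three flag dyads; [e_i - e_0]
     is orthogonal to [e_i + e_0] in every characteristic. *)
  have -> : delta_mx i i - delta_mx 0 0 *+ true
    = (delta_mx 0 i + delta_mx 0 0 : 'rV[F]_n.+1)^T
        *m (delta_mx 0 i - delta_mx 0 0)
      + (delta_mx i 0 - delta_mx 0 i) :> 'M[F]_n.+1.
    rewrite mulmxBr linearD /= !mulmxDl -!dE mulr1n.
    by rewrite opprD [X in _ = X + _]addrACA [RHS]addrAC !subrKA.
  apply: memvD; last apply: memvB.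
  - apply: dyad_in_span; rewrite mulmxBl linearD /= !mulmxDr !trmx_delta.
    rewrite !mul_delta_mx !mul_delta_mx_0 //.
    by rewrite addr0 add0r subrr.
  - by rewrite dE; apply: dyad_in_span; rewrite trmx_delta mul_delta_mx_0.
  - by rewrite dE; apply: dyad_in_span; rewrite trmx_delta mul_delta_mx_0.
have -> : M = \sum_i \sum_j M i j *: d i j.
  (* Replacing [E_ii] by [E_ii - E_00] changes the expansion of [M] by [tr(M) E_00], which is
     zero. *)
  have tr0 : \sum_i M i i *: delta_mx 0 0 = 0 :> 'M_n.+1.
    by rewrite -scaler_suml -/(\tr M) trM scale0r.
  rewrite [LHS]matrix_sum_delta -[LHS]subr0 -[X in _ - X]tr0 -sumrB.
  apply: eq_bigr => i _.
  rewrite (bigD1 i) //= [in RHS](bigD1 i) //= /d eqxx scalerBr addrAC.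
  by congr (_ + _); apply: eq_bigr => j ji; rewrite eq_sym (negPf ji) subr0.
by apply: memv_suml => i _; apply: memv_suml => j _; apply: memvZ.
Qed.

(** The trace is onto, as [c E_00] has trace [c], so its kernel has dimension [(n + 1)^2 - 1]. *)
Lemma dim_span_flag_points : \dim <<w>>%VS = (n ^ 2 + 2 * n)%N.
Proof.
rewrite span_flag_points; set f := linfun _.
have := limg_ker_dim f fullv; rewrite capfv dimvf dim_matrix.
have -> : (f @: fullv)%VS = fullv.
  apply/eqP; rewrite eqEsubv subvf; apply/subvP=> c _; apply/memv_imgP.
  exists ((c : F) *: delta_mx 0 0); rewrite ?memvf // lfunE /= linearZ /=.
  by rewrite /mxtrace (bigD1 0) //= big1 ?addr0 => [|i i0];
    rewrite !mxE ?eqxx ?mulr1 // (negPf i0).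
by rewrite dimvf /dim /= => H; nia.
Qed.

End Flags.

(** * Codes of projective systems: codewords, dimension, minimum distance *)

Section ProjectiveSystemCodes.
Variables (F : fieldType) (T : vectType F) (N : nat).

Lemma row_codeE k (G : 'M[F]_(k, N)) :
  row_code G = limg (linfun (mulmxr G : 'rV_k -> 'rV_N)).
Proof.
apply/eqP; rewrite eqEsubv; apply/andP; split.
  apply/span_subvP=> _ /mapP[i _ ->]; apply/memv_imgP.
  by exists (delta_mx 0 i); rewrite ?memvf // lfunE /= -rowE.
apply/subvP=> _ /memv_imgP[a _ ->]; rewrite lfunE /= mulmx_sum_row.
apply: memv_suml => i _; apply/memvZ/memv_span/mapP.
by exists i; rewrite ?mem_enum.
Qed.

Lemma functional_span (v : N.-tuple T) (f g : 'Hom(T, F^o)) u :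
  (forall j, f (tnth v j) = g (tnth v j)) -> u \in <<v>>%VS -> f u = g u.
Proof.
move=> fg; have: (<<v>> <= lker (f - g))%VS.
  apply/span_subvP=> _ /tnthP[j ->].
  by rewrite memv_ker add_lfunE opp_lfunE fg subrr.
move/subvP=> sub /sub; rewrite memv_ker add_lfunE opp_lfunE subr_eq0.
by move/eqP.
Qed.

Variables (v : N.-tuple T) (k : nat) (e : k.-tuple T).
Hypothesis eP : basis_of <<v>>%VS e.

Lemma coord_functional (f : 'Hom(T, F^o)) j :
  f (tnth v j) = (\row_i f e`_i *m generator_matrix v e) 0 j.
Proof.
rewrite [in LHS](coord_basis eP (memv_span (mem_tnth j v))) linear_sum mxE.
by apply: eq_bigr => i _; rewrite linearZ !mxE mulrC.
Qed.

(** This frees codewords from the basis [e]: the row [a] corresponds to the functional with values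
    [a_i] on [e_i]. *)
Lemma mem_code (c : 'rV[F]_N) :
  c \in row_code (generator_matrix v e) <->
  exists f : 'Hom(T, F^o), c = \row_j f (tnth v j).
Proof.
rewrite row_codeE; split=> [/memv_imgP[a _ ->]|[f ->]].
  pose f := \sum_i a 0 i *: linfun (coord e i : T -> F^o).
  exists f; apply/rowP=> j; rewrite lfunE /= !mxE sum_lfunE.
  by apply: eq_bigr => i _; rewrite scale_lfunE lfunE !mxE.
apply/memv_imgP; exists (\row_i f e`_i); rewrite ?memvf //.
by apply/rowP=> j; rewrite lfunE mxE coord_functional.
Qed.

(** Encoding is injective: if [a G = 0], the functional [\sum_i a_i coord_i] vanishes on [v], hence
    on its span, and its value at [e_i] is [a_i]. *)
Lemma dim_code : \dim (row_code (generator_matrix v e)) = k.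
Proof.
rewrite row_codeE limg_dim_eq ?dimvf ?dim_matrix ?mul1r //.
apply/eqP; rewrite -subv0; apply/subvP=> a; rewrite memv_cap memvf memv_ker lfunE.
move=> /eqP /= aG; rewrite memv0; apply/eqP/rowP=> i; rewrite mxE.
pose f := \sum_i a 0 i *: linfun (coord e i : T -> F^o).
have f0 j : f (tnth v j) = (0 : 'Hom(T, F^o)) (tnth v j).
  move/rowP/(_ j): aG; rewrite !mxE zero_lfunE sum_lfunE => aG.
  rewrite -[RHS]aG.
  by apply: eq_bigr => i' _; rewrite scale_lfunE lfunE !mxE.
have := functional_span f0 (basis_mem eP (mem_nth 0 (_ : i < size e)%N)).
rewrite size_tuple ltn_ord zero_lfunE => /(_ isT) fe0.
rewrite -[RHS]fe0 sum_lfunE.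
rewrite (bigD1 i) //= big1 ?addr0 => [|i' i'i].
  by rewrite scale_lfunE lfunE /= coord_free ?eqxx ?(basis_free eP) //= [RHS]mulr1.
rewrite scale_lfunE lfunE /= coord_free ?(basis_free eP) //.
by rewrite eq_sym (negPf i'i) scaler0.
Qed.

End ProjectiveSystemCodes.

(** By linearity a distance is the weight of a difference; [0 < d] makes the word of weight [d]
    differ from zero. *)
Lemma min_distance_weight (F : fieldType) N (C : {vspace 'rV[F]_N}) d :
  (0 < d)%N -> (exists2 c, c \in C & #|[set i | c 0 i != 0]| = d) ->
  (forall c, c \in C -> c != 0 -> (d <= #|[set i | c 0%R i != 0%R]|)%N) ->
  min_distance C d.
Proof.
move=> d0 [c0 c0C c0d] dle; split=> [|c c' cC c'C cc'].
  exists c0, 0; split=> //; first exact: mem0v.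
    apply: contraTneq d0 => c00; rewrite -c0d -leqNgt leqn0 cards_eq0.
    by apply/eqP/setP=> i; rewrite !inE c00 mxE eqxx.
  by rewrite -c0d; apply: eq_card => i; rewrite !inE mxE.
have -> : hamming_dist c c' = #|[set i | (c - c') 0 i != 0]|.
  by apply: eq_card => i; rewrite !inE !mxE subr_eq0.
by apply: dle; rewrite ?memvB // subr_eq0.
Qed.

(* [vpick] chooses a canonical vector on each line. *)
Lemma exists_representatives (F : fieldType) (T : vectType F) (s : seq T)
    (Omega : {vspace T} -> Prop) :
    (forall u, u \in s -> u != 0) ->
    (forall P, Omega P <-> exists2 u, u \in s & P = <[u]>%VS) ->
  exists N (v : N.-tuple T), represents v Omega.
Proof.
move=> s0 sO; pose r := undup [seq vpick <[u]>%VS | u <- s].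
have rE u : u != 0 -> <[vpick <[u]>]>%VS = <[u]>%VS.
  move=> u0; apply/eqP; rewrite eqEdim -memvE memv_pick !dim_vline.
  by rewrite vpick0 -dimv_eq0 dim_vline u0.
have r0 x : x \in r -> exists u, [/\ u \in s, x = vpick <[u]>%VS & <[x]>%VS = <[u]>%VS].
  rewrite mem_undup => /mapP[u us ->]; exists u; split=> //.
  by rewrite rE ?s0.
exists (size r), (in_tuple r); split=> [i|i j /= ij|P].
- have [u [us -> _]] := r0 _ (mem_tnth i (in_tuple r)).
  by rewrite vpick0 -dimv_eq0 dim_vline s0.
- apply: (elimT (tuple_uniqP (in_tuple r)) (undup_uniq _)).
  have [u [us Ei Eu]] := r0 _ (mem_tnth i (in_tuple r)).
  have [u' [us' Ej Eu']] := r0 _ (mem_tnth j (in_tuple r)).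
  by rewrite Ei Ej -Eu -Eu'; congr vpick; exact: ij.
- rewrite sO; split=> [[u us ->]|[i ->]].
    have /tnthP[i Ei] : vpick <[u]>%VS \in in_tuple r.
      by rewrite mem_undup; apply: map_f.
    by exists i; rewrite -Ei rE ?s0.
  have [u [us _ Eu]] := r0 _ (mem_tnth i (in_tuple r)).
  by exists u.
Qed.

(** * Matrix coordinates on the tensor product *)

Section TensorMatrix.
Variables (F : fieldType) (n : nat) (V T : vectType F).
Variable t : {bilinear V -> dual V -> T}.
Hypotheses (dimV : \dim {:V} = n) (tP : is_tensor_product t).

(** The universal property, applied to the dyad of coordinate rows, gives [phi]; [psi] is defined on
    matrix units by basis tensors. *)
Lemma tensor_matrix_iso : exists (phi : 'Hom(T, 'M[F]_n)) (psi : 'Hom('M[F]_n, T)),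
  [/\ cancel phi psi, cancel psi phi
    & forall P, Lambda1 t P <-> exists x y : 'rV[F]_n,
        [/\ x != 0, y != 0, x *m y^T = 0 & P = <[psi (y^T *m x)]>%VS]].
Proof.
have [X XB] : exists X : n.-tuple V, basis_of {:V} X.
  by rewrite -dimV; exists (vbasis {:V}); apply: vbasisP.
have Xf := basis_free XB.
pose r (x : V) : 'rV[F]_n := \row_i coord X i x.
(* The values of [xi] on the basis [X] are its coordinates in the dual basis [eps]. *)
pose s (xi : dual V) : 'rV[F]_n := \row_i (xi : 'Hom(V, F^o)) X`_i.
pose r' (u : 'rV[F]_n) : V := \sum_i u 0 i *: X`_i.
pose eps i : dual V := linfun (coord X i : V -> F^o).
pose s' (u : 'rV[F]_n) : dual V := \sum_i u 0 i *: eps i.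
have rK x : r' (r x) = x.
  rewrite [RHS](coord_basis XB (memvf x)); apply: eq_bigr => i _.
  by rewrite mxE.
have r'K u : r (r' u) = u.
  by apply/rowP=> i; rewrite mxE coord_sum_free.
have sK xi : s' (s xi) = xi.
  apply/lfunP=> x; rewrite sum_lfunE [in RHS](coord_basis XB (memvf x)) linear_sum.
  apply: eq_bigr => i _; rewrite scale_lfunE lfunE mxE linearZ /=.
  by rewrite [LHS]mulrC.
have s'K u : s (s' u) = u.
  apply/rowP=> i; rewrite mxE sum_lfunE (bigD1 i) //= big1 => [|j ji].
    by rewrite scale_lfunE lfunE /= coord_free // eqxx addr0 [LHS]mulr1.
  by rewrite scale_lfunE lfunE /= coord_free // eq_sym (negPf ji) scaler0.
have rsE x (xi : dual V) : r x *m (s xi)^T = ((xi : 'Hom(V, F^o)) x)%:M.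
  apply/matrixP=> i j; rewrite !ord1 !mxE eqxx mulr1n.
  rewrite [in RHS](coord_basis XB (memvf x)) linear_sum; apply: eq_bigr => l _.
  by rewrite !mxE linearZ.
pose b0 (x : V) (xi : dual V) : 'M[F]_n := (s xi)^T *m r x.
have b0P : bilinear_for *:%R *:%R b0.
  split=> [xi a x x'|x a xi xi']; rewrite /b0 /=.
    rewrite scalemxAr -mulmxDr; congr (_ *m _).
    by apply/rowP=> i; rewrite !mxE linearP.
  rewrite scalemxAl -mulmxDl; congr (_ *m _).
  by apply/matrixP=> i j; rewrite !mxE add_lfunE scale_lfunE.
pose Bb := bilinear_isBilinear.Build F V (dual V) _ *:%R *:%R b0 b0P.
pose b : {bilinear V -> dual V -> 'M[F]_n} := HB.pack b0 Bb.
have [phi [phiP _]] := tP b.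
pose psi0 (M : 'M[F]_n) : T := \sum_i \sum_j M i j *: t X`_j (eps i).
have psi0P : linear psi0.
  move=> a M M'; rewrite /psi0 scaler_sumr -big_split; apply: eq_bigr => i _ /=.
  rewrite scaler_sumr -big_split; apply: eq_bigr => j _ /=.
  by rewrite !mxE scalerDl scalerA.
pose Lp := GRing.isLinear.Build F _ _ *:%R psi0 psi0P.
pose psi1 : {linear 'M[F]_n -> T} := HB.pack psi0 Lp.
pose psi := linfun psi1.
have psiE x y : psi (y^T *m x) = t (r' x) (s' y).
  rewrite lfunE /= /psi0 linear_sumr; apply: eq_bigr => i _.
  rewrite linearZr_LR linear_sumlz scaler_sumr; apply: eq_bigr => j _.
  by rewrite linearZl_LR scalerA dyadE.
have psiK u : psi (phi u) = u.
  (* Both [psi \o phi] and the identity fix every [t x xi], so uniqueness in the universal property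
     identifies them. *)
  have [h [_ hU]] := tP t.
  have E1 : h = (psi \o phi)%VF.
    apply: hU => x xi; rewrite comp_lfunE phiP.
    by rewrite /= /b0 psiE rK sK.
  have E2 : h = \1%VF by apply: hU => x xi; rewrite id_lfunE.
  by rewrite -comp_lfunE -E1 E2 id_lfunE.
have phiK M : phi (psi M) = M.
  rewrite [in LHS](matrix_sum_delta M) !linear_sum [RHS]matrix_sum_delta.
  apply: eq_bigr => i _; rewrite !linear_sum; apply: eq_bigr => j _.
  rewrite !linearZ /=; congr (_ *: _).
  have -> : delta_mx i j = (delta_mx 0 i : 'rV[F]_n)^T *m delta_mx 0 j.
    by rewrite trmx_delta mul_delta_mx.
  by rewrite psiE phiP /= /b0 r'K s'K.
exists phi, psi; split=> // P; split=> [[x [xi [x0 xi0 xix ->]]]|[x [y [x0 y0 xy ->]]]].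
  exists (r x), (s xi); split.
  - apply: contra x0 => /eqP rx; rewrite -[x]rK rx /r' big1 // => i _.
    by rewrite mxE scale0r.
  - apply: contra xi0 => /eqP sx; rewrite -[xi]sK sx /s' big1 // => i _.
    by rewrite mxE scale0r.
  - by rewrite rsE xix raddf0.
  - by rewrite psiE rK sK.
exists (r' x), (s' y); split.
- apply: contra x0 => /eqP rx; rewrite -[x]r'K rx; apply/eqP/rowP=> i.
  by rewrite !mxE linear0.
- apply: contra y0 => /eqP sy; rewrite -[y]s'K sy; apply/eqP/rowP=> i.
  by rewrite !mxE zero_lfunE.
- have := rsE (r' x) (s' y); rewrite r'K s'K xy => /matrixP/(_ 0 0).
  by rewrite !mxE eqxx mulr1n.
- by rewrite psiE.
Qed.

End TensorMatrix.

(** * Trace functionals and the parameters of the code *)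

Lemma functional_mxtrace (F : fieldType) n (g : 'Hom('M[F]_n, F^o)) :
  exists A : 'M[F]_n, forall M, g M = \tr (A *m M).
Proof.
(* The indices are swapped because [tr(A E_ji) = A_ij]. *)
exists (\matrix_(i, j) g (delta_mx j i)) => M.
rewrite [in LHS](matrix_sum_delta M) linear_sum.
under eq_bigr do rewrite linear_sum.
rewrite exchange_big; apply: eq_bigr => i _; rewrite mxE.
by apply: eq_bigr => j _; rewrite linearZ mxE mulrC.
Qed.

Theorem theorem1p1 (F : finFieldType) (q n : nat) (V T : vectType F)
    (t : {bilinear V -> dual V -> T}) :
  #|F| = q -> (1 <= n)%N -> \dim {:V} = n.+1 -> is_tensor_product t ->
  (exists (N : nat) (C : {vspace 'rV[F]_N}), is_code_of (Lambda1 t) C) /\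
  forall (N : nat) (C : {vspace 'rV[F]_N}), is_code_of (Lambda1 t) C ->
    [/\ N%:R = (q%:R ^+ n.+1 - 1) * (q%:R ^+ n - 1) / (q%:R - 1) ^+ 2 :> rat,
        \dim C = (n ^ 2 + 2 * n)%N
      & min_distance C (q ^ (2 * n - 1) - q ^ (n - 1))].
Proof.
move=> <- n_gt0 dimV tP; have q1 : (1 < #|F|)%N := card_finNzRing_gt1 F.
have [phi [psi [phiK psiK LP]]] := tensor_matrix_iso dimV tP.
split.
  pose s := [seq psi (p.2^T *m p.1) | p <- enum [pred p | @is_flag F n p]].
  have [||N [v vP]] := @exists_representatives F T s (Lambda1 t).
  - move=> u /mapP[p]; rewrite mem_enum inE => /and3P[_ x0 y0] ->.
    by rewrite -(linear0 psi) (inj_eq (can_inj psiK)) dyad_neq0.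
  - move=> P; rewrite LP; split.
      case=> x [y [x0 y0 xy ->]]; exists (psi (y^T *m x)) => //.
      by apply/mapP; exists (x, y); rewrite // mem_enum inE /is_flag /= xy x0 y0 eqxx.
    case=> u /mapP[[x y]]; rewrite mem_enum inE => /and3P[/eqP /= xy x0 y0] -> ->.
    by exists x, y.
  exists N, (row_code (generator_matrix v (vbasis <<v>>))), v, _, (vbasis <<v>>).
  by split=> //; apply: vbasisP.
move=> N C [v [k [e [vP eP ->]]]].
(* The isomorphism [phi] carries the chosen representatives to representatives of the flag matrices,
   in the same order. *)
have wP : represents (map_tuple phi v) (@flag_points F n.+1).
  case: (vP) => v0 vinj vL; split=> [i|i j /=|P].
  - by rewrite tnth_map -(linear0 phi) (inj_eq (can_inj phiK)) v0.
  - rewrite !tnth_map => /(congr1 (fun U => psi @: U)%VS).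
    by rewrite !limg_line !phiK => /vinj.
  split=> [[x [y [x0 y0 xy ->]]]|[i ->]]; last first.
    have /LP[x [y [x0 y0 xy E]]] : Lambda1 t <[tnth v i]>%VS by apply/vL; exists i.
    by exists x, y; split=> //; rewrite tnth_map -limg_line E limg_line psiK.
  have /vL[i E] : Lambda1 t <[psi (y^T *m x)]>%VS by apply/LP; exists x, y.
  by exists i; rewrite tnth_map -limg_line -E limg_line psiK.
have wt (A : 'M[F]_n.+1) : #|[set i | (\row_j \tr (A *m phi (tnth v j))) 0 i != 0]|
    = weight (map_tuple phi v) A.
  by apply: eq_card => i; rewrite !inE mxE tnth_map.
have dE : (#|F| ^ (2 * n - 1) - #|F| ^ (n - 1)
    = #|F| ^ n.-1 * (#|F| ^ n - 1))%N.
  by rewrite mulnBr muln1 -expnD subn1; congr (_ ^ _ - _)%N; lia.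
split.
- have := card_flag_points wP => /(congr1 (fun m => m%:R : rat)).
  rewrite -subn1 (natrM _ N) (natrM _ (_ - 1)%N) natrX.
  rewrite !natrB ?expn_gt0 1?ltnW // !natrX => <-.
  by rewrite mulfK // expf_neq0 // subr_eq0 Num.Theory.pnatr_eq1 neq_ltn q1 orbT.
- rewrite (dim_code eP) -(dim_span_flag_points wP) -(size_basis eP).
  rewrite -limg_span limg_dim_eq //.
  have /lker0P/eqP-> := can_inj phiK; exact: capv0.
rewrite dE; apply: min_distance_weight.
- by rewrite muln_gt0 expn_gt0 ltnW //= subn_gt0 -(exp1n n) ltn_exp2r.
(* The rank-one projection [E_00] attains the bound. *)
- exists (\row_j \tr (delta_mx 0 0 *m phi (tnth v j))); last first.
    by rewrite wt (weight_delta wP).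
  apply/(mem_code eP).
  exists (linfun (mxtrace : 'M[F]_n.+1 -> F^o)
            \o linfun (mulmx (delta_mx 0 0) : 'M[F]_n.+1 -> 'M[F]_n.+1)
            \o phi)%VF.
  by apply/rowP=> j; rewrite !mxE !comp_lfunE !lfunE.
move=> _ /(mem_code eP)[f ->] c0.
have [A AE] := functional_mxtrace (f \o psi)%VF.
have cE : \row_j f (tnth v j) = \row_j \tr (A *m phi (tnth v j)).
  by apply/rowP=> j; rewrite !mxE -AE comp_lfunE phiK.
rewrite cE in c0 *; rewrite wt; apply: (weight_ge wP) => //.
(* A scalar [A] would give the zero codeword. *)
apply: contra c0 => /is_scalar_mxP[a ->]; apply/eqP/rowP=> j; rewrite [RHS]mxE.
have := weight_scalar wP a; rewrite -wt => /eqP; rewrite cards_eq0.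
by move/eqP/setP/(_ j); rewrite !inE => /negbFE/eqP.
Qed.
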